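(* There is a real function $E(y)$ with $E(y)=O(y^{-2})$ as $y\to\infty$ such that the following holds for all sufficiently large real $y$ and all real $x$ with $0<x<y$ for which $(x,y]$ contains at least one prime: if $$\lim_{\alpha\to\infty}M_\alpha(x,y)>1-\frac{2}{y}+E(y),$$ then there exists a twin prime pair in the interval $(x,y]$.
   Context: $p_n$ denotes the $n$-th prime. For real $0<x<y$, let $I=\{n:\ x<p_n\le y\}$, let $\pi(x,y)$ be the number of primes in $(x,y]$ (so $\pi(x,y)=|I|$), and let $r_n=\frac{p_n}{p_{n+1}-2}$. The $\alpha$-power mean (Hölder mean) of the elements $r_n$, $n\in I$, of $S_{(x,y]}=\left\{\frac{p_n}{p_{n+1}-2}:\ n\in I\right\}$ is $$M_\alpha(x,y)=\left(\frac{1}{\pi(x,y)}\sum_{n\in I}r_n^{\alpha}\right)^{1/\alpha},\qquad \alpha\in\mathbb{R},\ \alpha\neq 0.$$ The prime $p_{n+1}$ is the next prime after $p_n$ and need not lie in $(x,y]$. A twin prime pair (twin prime) is said to exist in $(x,y]$ if there is a prime $p$ with $x<p\le y$ such that $p+2$ is also prime (i.e. the first member of the pair lies in the interval). *)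

(* Defs.v *)
From mathcomp Require Import all_boot all_order all_algebra finmap.
From mathcomp Require Import all_classical all_reals all_analysis.

Set Implicit Arguments.
Unset Strict Implicit.
Unset Printing Implicit Defensive.

Import Order.TTheory GRing.Theory Num.Theory.
Import numFieldNormedType.Exports.

Local Open Scope classical_set_scope.
Local Open Scope ring_scope.

(* Lets the Landau notations be used with the filter at +oo. *)
Canonical pinfty_filter_on (R : numFieldType) :=
  FilterType (pinfty_nbhs R) (@proper_pinfty_nbhs R).

Lemma ex_prime_above (m : nat) : exists p, (m < p)%N && prime p.
Proof. by have [p ltmp pr_p] := prime_above m; exists p; rewrite ltmp. Qed.

Definition next_prime (m : nat) : nat := ex_minn (ex_prime_above m).

(* Indexing starts at 1: nth_prime 1 = 2, nth_prime 2 = 3, etc.; nth_prime 0 is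
   the dummy value 0, which is not a prime. *)
Definition nth_prime (n : nat) : nat := iter n next_prime 0%N.

Definition primes_in (R : realType) (x y : R) : set nat :=
  [set p : nat | prime p /\ x < p%:R <= y].

Definition prime_indices (R : realType) (x y : R) : set nat :=
  [set n : nat | (0 < n)%N /\ x < (nth_prime n)%:R <= y].

Definition prime_count (R : realType) (x y : R) : nat :=
  #|` fset_set (primes_in x y)|%fset.

(* The subtraction takes place in R; the denominator is positive for n >= 1. *)
Definition prime_ratio (R : realType) (n : nat) : R :=
  (nth_prime n)%:R / ((nth_prime n.+1)%:R - 2).

(* The sum runs over the indices n, so that equal ratios are counted with
   multiplicity. *)
Definition power_mean (R : realType) (x y alpha : R) : R :=
  ((prime_count x y)%:R^-1 *
     \sum_(n \in prime_indices x y) prime_ratio R n `^ alpha) `^ alpha^-1.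

(* Only the first member of the pair is required to lie in (x, y]. *)
Definition has_twin_prime (R : realType) (x y : R) : Prop :=
  exists p : nat, [/\ prime p, prime (p + 2) & x < p%:R <= y].

(* Main.v *)
(* If no prime of (x, y] starts a twin pair, then every p_n in (x, y] is odd
   (as 3 starts a twin pair) and p_(n+1) - p_n is at least 4, whence
   r_n <= p_n / (p_n + 2) <= y / (y + 2) <= 1 - 2 / y + 4 / y ^ 2.
   A power mean of positive exponent is at most the largest of its entries. *)
Require Import Defs.
From mathcomp Require Import all_boot all_order all_algebra finmap.
From mathcomp Require Import all_classical all_reals all_analysis.
From mathcomp Require Import lra zify.

Import Order.TTheory GRing.Theory Num.Theory.
Import numFieldNormedType.Exports.

Local Open Scope classical_set_scope.
Local Open Scope ring_scope.

Lemma next_primeP (m : nat) : (m < next_prime m)%N /\ prime (next_prime m).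
Proof. by rewrite /next_prime; case: ex_minnP => p /andP[]. Qed.

Lemma nth_prime_ltS (n : nat) : (nth_prime n < nth_prime n.+1)%N.
Proof. by have [] := next_primeP (nth_prime n). Qed.

Lemma prime_nth_prime (n : nat) : (0 < n)%N -> prime (nth_prime n).
Proof. by case: n => // n _; have [] := next_primeP (nth_prime n). Qed.

Lemma nth_prime_mono : {mono nth_prime : m n / (m <= n)%N}.
Proof. exact: leq_mono (homo_ltn ltn_trans nth_prime_ltS). Qed.

Lemma leq_nth_prime (n : nat) : (n <= nth_prime n)%N.
Proof. by elim: n => // n /leq_ltn_trans; apply; exact: nth_prime_ltS. Qed.

(** Both primes are odd, so the gap is even and positive; the gap 2 is excluded by the last
    hypothesis. *)
Lemma prime_gap_ge4 (p q : nat) : prime p -> prime q -> (2 < p)%N ->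
  (p < q)%N -> ~~ prime (p + 2) -> (p + 4 <= q)%N.
Proof.
move=> pp pq p_gt2 ltpq np2.
have op : odd p by case: (even_prime pp) => // p2; lia.
have oq : odd q by case: (even_prime pq) => // q2; lia.
have : q != (p + 2)%N by apply: contraNneq np2 => <-.
lia.
Qed.

(** [fset_set] sends an infinite set to the empty one, so the cardinalities below are meaningful
    only once finiteness is known. *)
Lemma finite_nat_le (R : realType) (y : R) (A : set nat) :
  (forall n, A n -> n%:R <= y) -> finite_set A.
Proof.
move=> Ay; apply: (sub_finite_set (B := `I_(Num.bound `|y|))) (finite_II _).
move=> n /= /Ay ley; rewrite -(ltr_nat R); apply: le_lt_trans ley _.
by rewrite (le_lt_trans (ler_norm y)) ?archi_boundP.
Qed.

Lemma finite_primes_in (R : realType) (x y : R) : finite_set (primes_in x y).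
Proof. by apply: (@finite_nat_le _ y) => n [_ /andP[]]. Qed.

Lemma finite_prime_indices (R : realType) (x y : R) :
  finite_set (prime_indices x y).
Proof.
apply: (@finite_nat_le _ y) => n [_ /andP[_]]; apply: le_trans.
by rewrite ler_nat leq_nth_prime.
Qed.

(** The injection [nth_prime] maps the indices to primes of the interval. This links the number of
    summands of the power mean to its normalising factor. *)
Lemma card_prime_indices_le (R : realType) (x y : R) :
  (#|` fset_set (prime_indices x y)| <= prime_count x y)%N.
Proof.
have injp : injective nth_prime := incn_inj nth_prime_mono.
have fI := finite_prime_indices R x y.
have <- : #|` (nth_prime @` fset_set (prime_indices x y))%fset| =
          #|` fset_set (prime_indices x y)| by rewrite card_imfset.
apply: fsubset_leq_card; rewrite -fset_set_image // -fset_set_sub.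
- by move=> _ [n [n_gt0 xny] <-]; split=> //; exact: prime_nth_prime.
- exact: finite_image.
- exact: finite_primes_in.
Qed.

Lemma prime_count_gt0 (R : realType) (x y : R) :
  primes_in x y !=set0 -> (0 < prime_count x y)%N.
Proof.
move=> [p xpy]; rewrite /prime_count cardfs_gt0; apply/fset0Pn; exists p.
by rewrite in_fset_set ?inE //; exact: finite_primes_in.
Qed.

Lemma power_mean_le (R : realType) (x y c alpha : R) :
  primes_in x y !=set0 -> 0 <= c -> 0 < alpha ->
  (forall n, prime_indices x y n -> 0 <= prime_ratio R n <= c) ->
  power_mean x y alpha <= c.
Proof.
move=> xy0 c_ge0 a_gt0 rc; rewrite /power_mean.
have N_gt0 : 0 < (prime_count x y)%:R :> R by rewrite ltr0n prime_count_gt0.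
have fI := finite_prime_indices R x y.
(* With [c] in this form, monotonicity of the outer power reduces the claim to the bases. *)
have -> : c = (c `^ alpha) `^ alpha^-1.
  by rewrite -powRrM divff ?gt_eqF // powRr1.
apply: ge0_ler_powR; rewrite ?nnegrE ?powR_ge0 ?invr_ge0 ?(ltW a_gt0) //.
  rewrite mulr_ge0 ?invr_ge0 ?ler0n // fsbig_finite //=.
  by apply: sumr_ge0 => n _; exact: powR_ge0.
rewrite ler_pdivrMl // fsbig_finite //=.
apply: (@le_trans _ _ (\sum_(n <- fset_set (prime_indices x y)) c `^ alpha)).
  rewrite big_seq [leRHS]big_seq; apply: ler_sum => n.
  rewrite in_fset_set // inE => /rc /andP[r_ge0 rlec].
  by apply: ge0_ler_powR; rewrite ?nnegrE // ltW.
rewrite big_const_seq count_predT iter_addr_0 mulr_natl.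
by rewrite ler_wpMn2l ?powR_ge0 // card_prime_indices_le.
Qed.

Lemma prime_ratio_le (R : realType) (x y : R) (n : nat) :
  3 <= y -> ~ has_twin_prime x y -> prime_indices x y n ->
  0 <= prime_ratio R n <= 1 - 2 / y + 4 * y ^- 2.
Proof.
move=> y_ge3 notwin [n_gt0 /andP[xp py]].
have pp := prime_nth_prime _ n_gt0; have pq := prime_nth_prime n.+1 isT.
have np2 : ~~ prime (nth_prime n + 2).
  by apply/negP => pp2; apply: notwin; exists (nth_prime n); rewrite xp.
have p_gt2 : (2 < nth_prime n)%N.
  (* If [p_n = 2], then [x < 2 < 3 <= y], and the pair 3, 5 contradicts [notwin]. *)
  rewrite ltn_neqAle prime_gt1 // andbT; apply/eqP => p2.
  apply: notwin; exists 3%N; split=> //; apply/andP; split=> //.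
  by rewrite (lt_trans xp) // ltr_nat -p2.
have := prime_gap_ge4 _ _ pp pq p_gt2 (nth_prime_ltS n) np2.
rewrite /prime_ratio; move: p_gt2 py {xp pp pq np2}.
move: (nth_prime n) (nth_prime n.+1) => p q p_gt2 py.
rewrite -(ler_nat R) natrD => pq.
have p_ge3 : 3 <= p%:R :> R by rewrite ler_nat.
have d_gt0 : 0 < q%:R - 2 :> R by lra.
rewrite divr_ge0 ?ler0n ?(ltW d_gt0) //= ler_pdivrMr //.
have -> : y ^- 2 = y^-1 ^+ 2 by rewrite exprVn.
have : y * y^-1 = 1 by rewrite divff // gt_eqF //; lra.
have : 0 < y^-1 by rewrite invr_gt0; lra.
(* Writing [z] for [1 / y], with [y * z = 1], makes the remaining goal polynomial. *)
move: y^-1 => z z_gt0 yz1.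
(* The quadratic equals [(1 - z) ^+ 2 + 3 * z ^+ 2]. *)
have c_ge0 : 0 <= 1 - 2 * z + 4 * z ^+ 2 by nra.
apply: (@le_trans _ _ ((1 - 2 * z + 4 * z ^+ 2) * (p%:R + 2))); last first.
  by apply: ler_wpM2l => //; lra.
have pz : p%:R * z <= 1 by rewrite -[leRHS]yz1 ler_pM2r.
have z_le : 2 * z <= 1 by nra.
(* The difference of the two sides of the goal is [2 * (1 - 2 * z) * (1 - p * z) + 8 * z ^+ 2]. *)
have : 0 <= (1 - 2 * z) * (1 - p%:R * z) by rewrite mulr_ge0 // subr_ge0.
nra.
Qed.

Theorem theorem2 (R : realType) :
  exists E : R -> R,
    E =O_ (+oo_R) (fun y : R => y ^- 2) /\
    (\forall y \near +oo, forall x : R,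
       0 < x -> x < y -> primes_in x y !=set0 ->
       lim (power_mean x y alpha @[alpha --> +oo]) > 1 - 2 / y + E y ->
       has_twin_prime x y).
Proof.
(* The constant 4 comes from [y / (y + 2) = 1 - 2 / y + 4 / (y * (y + 2))]. *)
exists (fun y => 4 * y ^- 2); split.
  apply/eqO_exP; exists 4 => //; apply: nearW => y.
  by rewrite normrM ger0_norm.
near=> y => x x_gt0 ltxy xy0; apply: contraPP => notwin; apply/negP.
have y_ge3 : 3 <= y by near: y; exact: nbhs_pinfty_ge.
rewrite -leNgt; set c := 1 - _ + _.
have rc n : prime_indices x y n -> 0 <= prime_ratio R n <= c.
  exact: prime_ratio_le.
have c_ge0 : 0 <= c.
  have : 2 / y <= 1 by rewrite ler_pdivrMr; lra.
  have : 0 <= y ^- 2 by rewrite invr_ge0 sqr_ge0.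
  by rewrite /c; lra.
have [cvgM|/dvgP ->] := pselect (cvg (power_mean x y alpha @[alpha --> +oo])).
  (* The bound [c] is uniform in [alpha > 0], so it passes to the limit. *)
  apply: limr_le => //; near=> alpha; apply: power_mean_le => //.
(* The junk value of a divergent limit is 0, so that the existence of the
   limit need not be established. *)
exact: c_ge0.
Unshelve. all: by end_near.
Qed.
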